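(* Let $\lambda,k>0$ and let $f(x)=f(x,\lambda,k)=\frac{k}{\lambda^{k}}x^{k-1}\exp\left(-(x/\lambda)^{k}\right)$, $x>0$, be the density of the Weibull distribution $W(\lambda,k)$. Let $X$ be a positive random variable with Laplace transform $\mathcal{L}_X(t)=\mathbb{E}[e^{-tX}]$, and suppose that $$\mathbb{E}\left|\frac{X f'(X)}{f(X)}\right|<\infty .$$ Then $X$ has the $W(\lambda,k)$-distribution if and only if $$t\,\mathcal{L}_{X}(t)= \mathbb{E}\left[\frac{1}{X}\left(k \left(\frac{X}{\lambda}\right)^k -k+1 \right) \left(1 -e^{-tX} \right) \right]\qquad\text{for each } t>0.$$
   Context: $W(\lambda,k)$ denotes the Weibull distribution with scale parameter $\lambda>0$ and shape parameter $k>0$, i.e. the distribution on $[0,\infty)$ with density $f(x,\lambda,k)=\frac{k}{\lambda^{k}}x^{k-1}\exp(-(x/\lambda)^{k})$. Here $f'$ is the derivative of $f$ with respect to $x$. *)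

(* Defs.v *)
From HB Require Import structures.
From mathcomp Require Import all_boot all_order all_algebra.
From mathcomp Require Import all_classical all_reals all_analysis.

Set Implicit Arguments.
Unset Strict Implicit.
Unset Printing Implicit Defensive.

Import Order.TTheory GRing.Theory Num.Theory.
Import numFieldNormedType.Exports.

Local Open Scope classical_set_scope.
Local Open Scope ring_scope.

(* The restriction matters: MathComp-Analysis has [x `^ a = 1] for [x < 0], so
   the bare formula does not vanish on the negative half-line. *)
Definition weibull_pdf (R : realType) (lambda k : R) : R -> R :=
  (fun x => k / lambda `^ k * x `^ (k - 1) * expR (- (x / lambda) `^ k))
    \_ `]0, +oo[.

Definition weibull_prob (R : realType) (lambda k : R) (A : set R) : \bar R :=
  (\int[lebesgue_measure]_(x in A) (weibull_pdf lambda k x)%:E)%E.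

Definition has_weibull_distribution (d : measure_display)
    (T : measurableType d) (R : realType) (P : probability T R)
    (X : {RV P >-> R}) (lambda k : R) : Prop :=
  forall A : set R, measurable A -> distribution P X A = weibull_prob lambda k A.

Definition laplace_transform (d : measure_display) (T : measurableType d)
    (R : realType) (P : probability T R) (X : T -> R) (t : R) : \bar R :=
  'E_P[(fun w => expR (- t * X w))%R]%E.

(* Main.v *)
Require Import Defs.
From HB Require Import structures.
From mathcomp Require Import all_boot all_order all_algebra.
From mathcomp Require Import all_classical all_reals all_analysis.
From mathcomp Require Import measurable_realfun.
From mathcomp Require Import ring lra.

Set Implicit Arguments.
Unset Strict Implicit.
Unset Printing Implicit Defensive.

Import Order.TTheory GRing.Theory Num.Theory.
Import numFieldNormedType.Exports.

Local Open Scope classical_set_scope.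
Local Open Scope ring_scope.

(** Write [f] for the Weibull density, [y x = (x / lambda) ^ k] for its
    cumulative hazard, [c x = k * y x - k + 1], so that [f' = - (c x / x) f],
    and [nu] for the law of [X]. The integrability hypothesis says that [c] is
    integrable with respect to [nu], and the identity to be characterized is
    the case [u x = 1 - exp (- t x)] of Stein's identity
    [E (u' (X)) = E ((c (X) / X) u (X))].

    If [X] is Weibull, then [u' f - (c x / x) u f] is the derivative of [u f],
    which for [u x = 1 - exp (- t x)] lies between [0] and [t k y exp (- y)]
    and hence vanishes at both ends of the half-line ([weibull_identity]).

    Conversely, the identity for [t = 1, 2, ...] gives, by linearity, Stein's
    identity whenever [u'] is a polynomial without constant term in
    [exp (- x)] and [u 0 = 0] ([stein_fun_poly]). If [u'] is continuous with
    compact support in the open half-line, the Weierstrass theorem gives such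
    a polynomial within [e] of [u'], its primitive is within [e x] of [u] by
    the mean value theorem, and since [E |c (X)|] is finite the identity
    extends to [u] ([stein_fun_continuous]). Taking [u = w / f], where [w] is
    the primitive of a continuous [F] with compact support and integral [0],
    makes [u' - (c x / x) u] equal to [F / f], so [E (F (X) / f (X)) = 0]
    ([integral_div_weibull_pdf]). With [F] a combination of [phi f] and
    [psi f] this says that [E (phi (X))] is proportional to the integral of
    [phi f] over all test functions [phi]
    ([test_function_proportional]). Letting test functions increase to
    indicator functions, and comparing total masses, the two laws agree on the
    rays that generate the Borel sets ([distribution_ray]). *)

(** * Uniform polynomial approximation on the unit interval *)

Section weierstrass.
Variable R : realType.
Implicit Types (p q : nat -> R) (x y c : R).

(** The Bernstein polynomial sum_i p i * C(n, i) X^i (1 - X)^(n - i), by the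
    Pascal recursion rather than through binomial coefficients. *)
Fixpoint bernstein (n : nat) (p : nat -> R) : {poly R} :=
  if n is m.+1 then
    (1 - 'X) * bernstein m p + 'X * bernstein m (p \o succn)
  else (p 0)%:P.

Lemma bernsteinS n p y : (bernstein n.+1 p).[y] =
  (1 - y) * (bernstein n p).[y] + y * (bernstein n (p \o succn)).[y].
Proof. by rewrite /= !hornerE. Qed.

Lemma bernstein_const n c y : (bernstein n (fun=> c)).[y] = c.
Proof.
elim: n => [|n IH]; first by rewrite /= hornerC.
rewrite bernsteinS (_ : (fun=> c) \o succn = fun=> c)// IH; ring.
Qed.

Lemma bernstein_lin n p q c y :
  (bernstein n (fun i => p i + c * q i)).[y] =
  (bernstein n p).[y] + c * (bernstein n q).[y].
Proof.
elim: n p q => [|n IH] p q; first by rewrite /= !hornerC.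
rewrite !bernsteinS IH.
rewrite (_ : _ \o succn = fun i => (p \o succn) i + c * (q \o succn) i)// IH.
ring.
Qed.

Lemma bernstein_le n p q y : 0 <= y <= 1 ->
  (forall i, (i <= n)%N -> p i <= q i) ->
  (bernstein n p).[y] <= (bernstein n q).[y].
Proof.
move=> /andP[y0 y1]; elim: n p q => [|n IH] p q pq.
  by rewrite /= !hornerC pq.
rewrite !bernsteinS lerD// ler_wpM2l ?subr_ge0//; apply: IH => i ni.
  by rewrite pq// (leq_trans ni).
by rewrite /= pq.
Qed.

(** The second moment of a binomial law about an arbitrary centre. *)
Lemma bernstein_variance n c y :
  (bernstein n (fun i => (i%:R - c) ^+ 2)).[y] =
  n%:R * y * (1 - y) + (n%:R * y - c) ^+ 2.
Proof.
elim: n c => [|n IH] c; first by rewrite /= hornerC; ring.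
rewrite bernsteinS IH.
rewrite (_ : _ \o succn = fun i => (i%:R - (c - 1)) ^+ 2); last first.
  by apply/funext => i /=; rewrite -natr1; ring.
rewrite IH -natr1; ring.
Qed.

Lemma unif_continuous_itv (G : R -> R) (e a b : R) : continuous G -> 0 < e ->
  exists2 r : R, 0 < r &
    forall x y, a <= x <= b -> `|x - y| < r -> `|G x - G y| < e.
Proof.
move=> cG e0.
have /compact_near_coveringP cK := @segment_compact R a b.
have /= : \forall r \near (0:R)^'+, `[a, b] `<=`
    [set x | forall y, `|x - y| < r -> `|G x - G y| < e].
  apply: cK => x _ /=.
  have e2 : 0 < e / 2 by rewrite divr_gt0.
  have := cG x => /cvgrPdist_lt /(_ _ e2) [/= s s0 sG].
  exists (ball x (s / 2), [set r | r < s / 2]) => /=.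
    split; first by apply: nbhsx_ballx; rewrite divr_gt0.
    by apply: nbhs_right_lt; rewrite divr_gt0.
  case=> z r /= [xz rs] y zy.
  have xs : `|x - z| < s by rewrite (lt_trans xz)//; lra.
  have ys : `|x - y| < s.
    rewrite (_ : x - y = (x - z) + (z - y)); last by ring.
    rewrite (le_lt_trans (ler_normD _ _))//.
    by move: xz; rewrite /ball/= => xz; lra.
  have h1 := sG _ xs; have h2 := sG _ ys.
  rewrite (_ : G z - G y = (G x - G y) - (G x - G z)); last by ring.
  by rewrite (le_lt_trans (ler_normB _ _))//; lra.
move=> [/= s s0 sG]; exists (s / 2); first by rewrite divr_gt0.
move=> x y xab; apply: (sG (s / 2)) => //=; last by rewrite divr_gt0.
by rewrite sub0r normrN gtr0_norm ?divr_gt0//; lra.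
Qed.

Theorem weierstrass_approximation (G : R -> R) (e : R) :
  continuous G -> 0 < e ->
  exists p : {poly R}, forall y, 0 <= y <= 1 -> `|G y - p.[y]| <= e.
Proof.
move=> cG e0; have e2 : 0 < e / 2 by rewrite divr_gt0.
have [r r0 Gr] := unif_continuous_itv 0 1 cG e2.
have [M M0 GM] : exists2 M : R, 0 < M & forall x, 0 <= x <= 1 -> `|G x| <= M.
  have := compact_bounded (continuous_compact
    (continuous_subspaceT cG) (@segment_compact R 0 1)).
  move=> [N [_ NG]]; exists (Num.max 0 N + 1).
    by rewrite ltr_pwDr// le_max lexx.
  move=> x x01; apply: (NG (Num.max 0 N + 1)); last by exists x.
  by rewrite ltr_pwDr// le_max lexx orbT.
(* Chebyshev's inequality bounds the mass at distance at least [r] from [y]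
   by [y (1 - y) / (N r^2) <= 1 / (2 N r^2)], where [|G (i / N) - G y|] is at
   most [2 M]; hence the choice of [N] with [K / N <= e]. *)
pose K : R := 2 * M / r ^+ 2.
have K0 : 0 < K by rewrite divr_gt0 ?mulr_gt0// exprn_gt0.
have [n nK] : exists n : nat, K / e <= n.+1%:R.
  exists (Num.truncn (K / e)).
  by rewrite ltW// truncnS_gt.
exists (bernstein n.+1 (fun i => G (i%:R / n.+1%:R))) => y y01.
set N : R := n.+1%:R in nK *.
have N0 : 0 < N by rewrite ltr0n.
have key i : (i <= n.+1)%N ->
    `|G (i%:R / N) - G y| <= e / 2 + K / N ^+ 2 * (i%:R - N * y) ^+ 2.
  move=> iN.
  have i01 : 0 <= i%:R / N <= 1.
    rewrite divr_ge0 ?(ltW N0)//=.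
    by rewrite ler_pdivrMr// mul1r ler_nat.
  have [xy|xy] := ltP `|i%:R / N - y| r.
    apply: (le_trans (ltW (Gr _ _ i01 xy))).
    by rewrite lerDl mulr_ge0 ?sqr_ge0// divr_ge0 ?(ltW K0)// exprn_ge0// ltW.
  have -> : K / N ^+ 2 * (i%:R - N * y) ^+ 2 =
      2 * M * ((i%:R / N - y) / r) ^+ 2.
    by rewrite /K; field; rewrite !gt_eqF.
  set z := (_ / r) ^+ 2.
  have z1 : 1 <= z.
    rewrite /z -(real_normK (num_real _)) expr_ge1// normrM normfV.
    rewrite (gtr0_norm r0).
    by rewrite ler_pdivlMr// mul1r.
  apply: (@le_trans _ _ (2 * M)).
    rewrite (le_trans (ler_normB _ _))//.
    have h1 := GM _ i01; have h2 := GM _ y01; lra.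
  by nra.
have E : (bernstein n.+1
    (fun i => e / 2 + K / N ^+ 2 * (i%:R - N * y) ^+ 2)).[y] <= e.
  rewrite (bernstein_lin _ (fun=> e / 2)) bernstein_const bernstein_variance.
  rewrite -/N subrr expr0n/= addr0.
  have y14 : y * (1 - y) <= 1 / 2 by have := sqr_ge0 (y - 1 / 2); nra.
  have -> : K / N ^+ 2 * (N * y * (1 - y)) = K / N * (y * (1 - y)).
    by field; rewrite gt_eqF.
  have KN : K / N <= e by rewrite ler_pdivrMr// mulrC -ler_pdivrMr.
  have y0 : 0 <= y * (1 - y) by case/andP: y01 => *; nra.
  have KN0 : 0 <= K / N by rewrite divr_ge0// ltW.
  have h : K / N * (y * (1 - y)) <= K / N * (1 / 2) by exact: ler_wpM2l.
  move: (K / N) (y * (1 - y)) h KN => u v h KN; lra.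
set B := (X in _ - X.[y]).
(* [G y] is the value at [y] of the Bernstein polynomial of a constant *)
have B1 : (B.[y] + (-1) * G y) <= e.
  rewrite -{1}(bernstein_const n.+1 (G y) y) -bernstein_lin.
  apply: le_trans E; apply: bernstein_le => // i iN.
  apply: le_trans (key _ iN); rewrite mulN1r; exact: ler_norm.
have B2 : (G y + (-1) * B.[y]) <= e.
  rewrite -{1}(bernstein_const n.+1 (G y) y) -bernstein_lin.
  apply: le_trans E; apply: bernstein_le => // i iN.
  by apply: le_trans (key _ iN); rewrite mulN1r distrC ler_norm.
by rewrite ler_norml; apply/andP; split; lra.
Qed.

End weierstrass.

(** * Real functions *)

Section real_functions.
Variable R : realType.

Lemma is_derive_ext (g h : R -> R) (x dg dh : R) :
  is_derive x 1 g dg -> g =1 h -> dg = dh -> is_derive x 1 h dh.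
Proof. by move=> hg /funext <- <-. Qed.

Lemma is_derive_continuous (g : R -> R) (x dg : R) :
  is_derive x 1 g dg -> {for x, continuous g}.
Proof.
by move=> h; apply/differentiable_continuous/derivable1_diffP/ex_derive.
Qed.

Lemma is_derive_onem_expRN (t x : R) :
  is_derive x 1 (fun z => 1 - expR (- t * z)) (t * expR (- t * x)).
Proof.
have hl : is_derive x 1 (fun z : R => - t * z) (- t).
  apply: is_derive_ext (is_deriveZ (- t) (is_derive_id x 1)) _ _ => //.
  by rewrite /GRing.scale/= mulr1.
have he := @is_derive1_comp _ expR (fun z => - t * z) x _ _
  (is_derive_expR _) hl.
have h1 : is_derive x 1 (cst 1 : R -> R) 0 by exact: is_derive_cst.
by apply: is_derive_ext (is_deriveB h1 he) _ _ => //; ring.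
Qed.

(** The two half-lines [x > 0] and [x < a] overlap. *)
Lemma continuous_gt0_lt (g : R -> R) (a : R) : 0 < a ->
  (forall x : R, 0 < x -> {for x, continuous g}) ->
  (forall x, x <= a -> g x = 0) -> continuous g.
Proof.
move=> a0 cg ga x; have [x0|x0] := ltP 0 x; first exact: cg.
have g0 : \forall s \near x, g s = 0.
  near=> s; apply: ga; rewrite ltW//; near: s.
  by apply: lt_nbhsl; exact: le_lt_trans x0 a0.
by rewrite /continuous_at (nbhs_singleton g0); exact: cvg_near_cst.
Unshelve. all: by end_near. Qed.

Lemma mulr_expRN_le (s : R) : 0 < s -> s * expR (- s) <= 4 / s.
Proof.
move=> s0; rewrite expRN ler_pdivrMr ?expR_gt0// mulrAC ler_pdivlMr//.
have e2 : expR s = expR (s / 2) ^+ 2.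
  by rewrite -expRM_natl; congr expR; field.
have := expR_ge1Dx (s / 2); rewrite e2; set E := expR _ => hE.
nra.
Qed.

Lemma onem_expRN_itv (t x : R) : 0 <= t -> 0 <= x ->
  0 <= 1 - expR (- t * x) <= t * x.
Proof.
move=> t0 x0; rewrite subr_ge0 -{1}expR0 ler_expR mulNr oppr_le0 mulr_ge0//=.
have := expR_ge1Dx (- (t * x)); lra.
Qed.

Lemma measurable_inv : measurable_fun [set: R] (@GRing.inv R).
Proof.
rewrite -(setUv [set 0]); apply/measurable_funU => //; first exact: measurableC.
split; first exact: measurable_fun_set1.
apply: open_continuous_measurable_fun.
  exact/closed_openC/closed_eq.
by move=> x; rewrite inE /= => /eqP x0; exact: inv_continuous.
Qed.

Lemma measurable_expRM (t : R) :
  measurable_fun [set: R] (fun x => expR (- t * x)).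
Proof. by apply: measurableT_comp => //; exact: measurable_funM. Qed.

End real_functions.

(** * The Weibull density *)

Section weibull_density.
Variables (R : realType) (lambda k : R).
Hypotheses (lambda_gt0 : 0 < lambda) (k_gt0 : 0 < k).
Local Notation mu := (@lebesgue_measure R).
Local Notation D := (`]0, +oo[%classic : set R).
Local Notation f := (weibull_pdf lambda k).

(** The cumulative hazard of the Weibull law: its survival function at
    positive [x] is [expR (- weibull_hazard x)]. *)
Definition weibull_hazard (x : R) : R := (x / lambda) `^ k.

(** The opposite [- x f'(x) / f(x)] of the scaled score of the density. *)
Definition weibull_score (x : R) : R := k * weibull_hazard x - k + 1.

Local Notation y := weibull_hazard.
Local Notation c := weibull_score.

Lemma weibull_hazard_gt0 x : 0 < x -> 0 < y x.
Proof. by move=> x0; rewrite powR_gt0 ?divr_gt0. Qed.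

Lemma weibull_pdf_le0 x : x <= 0 -> f x = 0.
Proof.
by move=> x0; rewrite /weibull_pdf patchE memNset//= in_itv/= andbT ltNge x0.
Qed.

Lemma weibull_pdfE x : 0 < x -> f x = k * y x * expR (- y x) / x.
Proof.
move=> x0; rewrite /weibull_pdf patchE mem_set//=; last by rewrite in_itv/= x0.
rewrite -/(y x); set E := expR _.
have -> : y x = x * x `^ (k - 1) / lambda `^ k.
  rewrite mulr_powRB1 ?ltW//.
  have -> : x `^ k = lambda `^ k * y x.
    rewrite /y -powRM ?ltW// ?divr_gt0//; congr (_ `^ _).
    by field; rewrite gt_eqF.
  by field; rewrite gt_eqF// powR_gt0.
by field; rewrite !gt_eqF// powR_gt0.
Qed.

Lemma weibull_pdf_gt0 x : 0 < x -> 0 < f x.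
Proof.
move=> x0; rewrite weibull_pdfE// divr_gt0// !mulr_gt0 ?expR_gt0//.
exact: weibull_hazard_gt0.
Qed.

Lemma weibull_pdf_ge0 x : 0 <= f x.
Proof.
by have [/weibull_pdf_le0->//|/weibull_pdf_gt0/ltW] := leP x 0.
Qed.

Lemma is_derive_weibull_hazard (x : R) : 0 < x -> is_derive x 1 y (k * y x / x).
Proof.
move=> x0; have xl : 0 < x / lambda by rewrite divr_gt0.
have h1 : is_derive x 1 (fun z : R => z / lambda) lambda^-1.
  have -> : (fun z : R => z / lambda) = lambda^-1 *: id.
    by apply/funext => z; rewrite /= mulrC.
  by apply: is_derive_eq; rewrite /GRing.scale/= mulr1.
have h := @is_derive1_comp _ (fun z => z `^ k) (fun z => z / lambda) x _ _
  (is_derive1_powR k xl) h1.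
apply: is_derive_ext h _ _ => //.
have -> : y x = (x / lambda) * (x / lambda) `^ (k - 1).
  by rewrite mulr_powRB1// ltW.
by field; rewrite !gt_eqF.
Qed.

Lemma is_derive_expRN_hazard (x : R) : 0 < x ->
  is_derive x 1 (fun z => expR (- y z)) (- (k * y x / x) * expR (- y x)).
Proof.
move=> x0; have hy := is_derive_weibull_hazard x0.
have hn : is_derive x 1 (fun z => - y z) (- (k * y x / x)) by exact: is_deriveN.
have h := @is_derive1_comp _ expR (fun z => - y z) x _ _ (is_derive_expR _) hn.
apply: is_derive_ext h _ _ => //.
by rewrite mulrC.
Qed.

Lemma is_derive_weibull_pdf (x : R) : 0 < x ->
  is_derive x 1 f (- (c x / x) * f x).
Proof.
move=> x0; have xn0 : x != 0 by rewrite gt_eqF.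
apply: (@near_eq_is_derive _ _ _ (fun z => k * y z * expR (- y z) / z)).
  near=> z; rewrite weibull_pdfE//.
  by near: z; exact: lt_nbhsr.
have hV := is_deriveV (f := id) xn0 (is_derive_id x 1).
have hk := is_deriveM (is_derive_cst k x 1) (is_derive_weibull_hazard x0).
have h := is_deriveM (is_deriveM hk (is_derive_expRN_hazard x0)) hV.
apply: is_derive_ext h _ _ => //.
rewrite weibull_pdfE// /weibull_score /GRing.scale/= !fctE /cst/=.
by field.
Unshelve. all: by end_near. Qed.

Lemma continuous_weibull_hazard (x : R) : 0 < x -> {for x, continuous y}.
Proof. by move=> /is_derive_weibull_hazard/is_derive_continuous. Qed.

Lemma continuous_weibull_pdf (x : R) : 0 < x -> {for x, continuous f}.
Proof. by move=> /is_derive_weibull_pdf/is_derive_continuous. Qed.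

Lemma continuous_weibull_score (x : R) : 0 < x -> {for x, continuous c}.
Proof.
move=> x0; apply: cvgD; last exact: cvg_cst.
apply: cvgB; last exact: cvg_cst.
by apply: cvgM; [exact: cvg_cst|exact: continuous_weibull_hazard].
Qed.

Lemma measurable_weibull_hazard : measurable_fun [set: R] y.
Proof.
by apply: (measurableT_comp (measurable_powR k)); exact: measurable_funM.
Qed.

Lemma measurable_weibull_score : measurable_fun [set: R] c.
Proof.
apply: measurable_funD => //; apply: measurable_funB => //.
apply: measurable_funM => //; exact: measurable_weibull_hazard.
Qed.

Lemma measurable_weibull_pdf : measurable_fun [set: R] f.
Proof.
apply/(measurable_restrictT _ _).1 => //; apply: measurable_funTS.
apply: measurable_funM.
  by apply: measurable_funM => //; exact: measurable_powR.
apply: measurableT_comp => //; apply: measurableT_comp => //.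
exact: measurable_weibull_hazard.
Qed.

(** The inverse of the hazard on the positive half-line. *)
Definition weibull_quantile (s : R) : R := lambda * s `^ k^-1.
Local Notation q := weibull_quantile.

Lemma weibull_quantile_gt0 s : 0 < s -> 0 < q s.
Proof. by move=> s0; rewrite mulr_gt0 ?powR_gt0. Qed.

Lemma weibull_quantileK s : 0 <= s -> y (q s) = s.
Proof.
move=> s0; rewrite /y /q mulrC mulKf ?gt_eqF// -powRrM mulVf ?gt_eqF//.
exact: powRr1.
Qed.

Lemma weibull_hazardK x : 0 <= x -> q (y x) = x.
Proof.
move=> x0; rewrite /y /q -powRrM mulfV ?gt_eqF// powRr1 ?divr_ge0// ?ltW//.
by rewrite mulrC divfK ?gt_eqF.
Qed.

Lemma weibull_quantile_le s t : 0 <= s -> s <= t -> q s <= q t.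
Proof.
move=> s0 st; rewrite ler_pM2l// ge0_ler_powR ?nnegrE ?invr_ge0 ?(ltW k_gt0)//.
exact: le_trans st.
Qed.

Lemma weibull_quantile_lt s t : 0 <= s -> s < t -> q s < q t.
Proof.
move=> s0 st; rewrite ltr_pM2l// gt0_ltr_powR ?nnegrE ?invr_gt0//.
exact: le_trans (ltW st).
Qed.

(** Compact intervals exhausting the positive half-line, on whose end points
    the hazard is explicit. *)
Definition weibull_itv (n : nat) : interval R :=
  `[q n.+1%:R^-1, q n.+2%:R].
Local Notation A := weibull_itv.

Lemma weibull_itv_lt n : q n.+1%:R^-1 < q n.+2%:R.
Proof.
rewrite weibull_quantile_lt// ?invr_ge0//.
rewrite (@le_lt_trans _ _ 1) ?ltr1n// invf_le1 ?ltr0n// ler1n//.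
Qed.

Lemma weibull_itv_gt0 n x : x \in A n -> 0 < x.
Proof.
rewrite in_itv/= => /andP[qx _]; apply: lt_le_trans qx.
by rewrite weibull_quantile_gt0// invr_gt0 ltr0n.
Qed.

Lemma weibull_itv_homo n m : (n <= m)%N -> [set` A n] `<=` [set` A m].
Proof.
move=> nm x /=; rewrite !in_itv/= => /andP[h1 h2]; apply/andP; split.
  apply: le_trans h1; rewrite weibull_quantile_le ?invr_ge0//.
  by rewrite lef_pV2 ?posrE ?ltr0n// ler_nat.
by apply: (le_trans h2); rewrite weibull_quantile_le// ler_nat.
Qed.

Lemma near_weibull_itv x : 0 < x -> \forall n \near \oo, x \in A n.
Proof.
move=> x0; have y0 := weibull_hazard_gt0 x0.
have h1 : \forall n \near \oo, (y x)^-1 <= n%:R.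
  exact: nbhs_infty_ger.
have h2 : \forall n \near \oo, y x <= n%:R.
  exact: nbhs_infty_ger.
near=> n; rewrite in_itv/= -(weibull_hazardK (ltW x0)); apply/andP; split.
  rewrite weibull_quantile_le ?invr_ge0// -[leRHS]invrK.
  rewrite lef_pV2 ?posrE ?ltr0n ?invr_gt0//.
  rewrite (@le_trans _ _ n%:R) ?ler_nat//; by near: n.
rewrite weibull_quantile_le ?(ltW y0)//.
rewrite ltW// (@le_lt_trans _ _ n%:R) ?ltr_nat//; by near: n.
Unshelve. all: by end_near. Qed.

Lemma weibull_itv_bigcup : \bigcup_n [set` A n] = D.
Proof.
apply/seteqP; split => [x [n _ /= /weibull_itv_gt0 x0]|x /=].
  by rewrite in_itv/= x0.
rewrite in_itv/= andbT => x0.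
have [N _ /(_ _ (leqnn N)) h] := near_weibull_itv x0.
by exists N.
Qed.

(** The fundamental theorem of calculus on the exhausting intervals. *)
Lemma integral_weibull_itv (g G : R -> R) n :
  (forall x, 0 < x -> {for x, continuous g}) ->
  (forall x : R, 0 < x -> is_derive x 1 G (g x)) ->
  (\int[mu]_(x in [set` A n]) (g x)%:E =
   (G (q n.+2%:R))%:E - (G (q n.+1%:R^-1))%:E)%E.
Proof.
move=> cg dG; have qq := weibull_itv_lt n.
have A0 x : x \in `[q n.+1%:R^-1, q n.+2%:R] -> 0 < x by exact: weibull_itv_gt0.
apply: continuous_FTC2 => //.
- apply: continuous_in_subspaceT => x; rewrite inE/= => xA.
  exact/cg/A0.
- have cG x : x \in `[q n.+1%:R^-1, q n.+2%:R] -> {for x, continuous G}.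
    by move=> /A0/dG/is_derive_continuous.
  split.
  + by move=> x /subset_itv_oo_cc/A0/dG h; exact: (@ex_derive _ _ _ _ _ _ _ h).
  + by apply: cvg_at_right_filter; apply: cG; rewrite in_itv/= lexx ltW.
  + by apply: cvg_at_left_filter; apply: cG; rewrite in_itv/= lexx ltW.
- by move=> x /subset_itv_oo_cc/A0/dG h; rewrite derive1E derive_val.
Qed.

(** The density may be unbounded at [0], hence the exhaustion by compact
    intervals. *)
Lemma integral_weibull_pdf : (\int[mu]_(x in D) (f x)%:E = 1)%E.
Proof.
pose G (x : R) := - expR (- y x).
have dG (x : R) : 0 < x -> is_derive x 1 G (f x).
  move=> x0.
  apply: is_derive_ext (is_deriveN (is_derive_expRN_hazard x0)) _ _ => //.
  by rewrite weibull_pdfE//; field; rewrite gt_eqF.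
rewrite -weibull_itv_bigcup.
have E n : (\int[mu]_(x in [set` A n]) (f x)%:E =
    (expR (- n.+1%:R^-1) - expR (- n.+2%:R))%:E)%E.
  rewrite (integral_weibull_itv n (@continuous_weibull_pdf) dG) /G.
  by rewrite !weibull_quantileK ?invr_ge0// -EFinB opprK addrC.
have cvgE : (fun n => \int[mu]_(x in [set` A n]) (f x)%:E)%E @ \oo --> 1%E.
  rewrite (eq_cvg _ _ E); apply: cvg_EFin; first exact: nearW.
  rewrite -[X in _ --> X]subr0 -[X in _ --> X - _](expR0 R) -oppr0; apply: cvgB.
    apply: continuous_cvg; first exact: continuous_expR.
    by apply: cvgN; exact: cvg_harmonic.
  rewrite oppr0.
  apply: (@cvg_comp _ _ _ (fun n : nat => n.+2%:R : R) (fun x => expR (- x)));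
    last exact: cvgr_expR.
  apply: (cvg_comp (fun n : nat => n.+2) (fun n => n%:R : R)) cvgr_idn.
  apply/cvgnyPge => m; near=> n; apply: leq_trans (leqW (leqnSn n)).
  by near: n; exact: nbhs_infty_ge.
have cvgA := @ge0_nondecreasing_set_cvg_integral _ (measurableTypeR R) R
  (fun n => [set` A n]) (EFin \o f) lebesgue_measure.
apply: (cvg_unique _ (cvgA _ _ _ _) cvgE) => //.
- by move=> n m nm; apply/subsetPset; exact: weibull_itv_homo.
- move=> n; apply/measurable_funTS/measurable_EFinP.
  exact: measurable_weibull_pdf.
- by move=> n x _; rewrite lee_fin weibull_pdf_ge0.
Unshelve. all: by end_near. Qed.

Lemma weibull_probI (E : set R) : measurable E ->
  weibull_prob lambda k E = weibull_prob lambda k (E `&` D).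
Proof.
move=> mE; rewrite /weibull_prob integral_mkcondr; apply: eq_integral => x _.
rewrite patchE; case: ifPn => //; rewrite notin_setE/= in_itv/= andbT => /negP.
by rewrite -leNgt => x0; rewrite weibull_pdf_le0.
Qed.

(** At nonpositive points the density vanishes, and the quotient by [0] is
    [0]. *)
Lemma weibull_scoreE x :
  x * f^`()%classic x / f x = if 0 < x then - c x else 0.
Proof.
case: ifPn => [x0|]; last first.
  by rewrite -leNgt => x0; rewrite (weibull_pdf_le0 x0) invr0 mulr0.
have h := is_derive_weibull_pdf x0.
rewrite derive1E derive_val; field.
by rewrite !gt_eqF// weibull_pdf_gt0.
Qed.

End weibull_density.

Section weibull_measure.
Variables (R : realType) (lambda k : R).
Hypotheses (lambda_gt0 : 0 < lambda) (k_gt0 : 0 < k).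
Local Notation W := (weibull_prob lambda k).

Let W0 : W set0 = 0%E. Proof. exact: integral_set0. Qed.

Let W_ge0 A : (0 <= W A)%E.
Proof. by apply: integral_ge0 => x _; rewrite lee_fin weibull_pdf_ge0. Qed.

Let W_sigma_additive : semi_sigma_additive W.
Proof.
move=> /= F mF tF mUF; rewrite /weibull_prob; apply: cvg_toP.
  apply: ereal_nondecreasing_is_cvgn => m n mn.
  by apply: lee_sum_nneg_natr => // *; exact: W_ge0.
rewrite ge0_integral_bigcup//=.
- apply/measurable_funTS/measurable_EFinP; exact: measurable_weibull_pdf.
- by move=> x _; rewrite lee_fin weibull_pdf_ge0.
Qed.

HB.instance Definition _ := isMeasure.Build _ _ _
  W W0 W_ge0 W_sigma_additive.

(** [weibull_prob] as a measure on the Borel sets. *)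
Definition weibull_measure : {measure set R -> \bar R} := W.

End weibull_measure.

(** * Transfer to the half-line *)

Section integral_density.
Context d (T : measurableType d) (R : realType).
Variables (nu : {finite_measure set T -> \bar R})
          (mu : {sigma_finite_measure set T -> \bar R}).
Variable p : T -> R.
Hypotheses (ip : mu.-integrable setT (EFin \o p)) (p_ge0 : forall x, 0 <= p x).
Hypothesis nuE : forall A, measurable A ->
  nu A = (\int[mu]_(x in A) (p x)%:E)%E.

(** By uniqueness of the Radon-Nikodym derivative, [p] is that of [nu]. *)
Lemma integral_density (A : set T) (g : T -> R) : measurable A ->
  nu.-integrable A (EFin \o g) ->
  (\int[nu]_(x in A) (g x)%:E = \int[mu]_(x in A) (g x * p x)%:E)%E.
Proof.
move=> mA ig; have mp := measurable_int _ ip.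
have numu : nu `<< mu.
  apply/null_content_dominatesP => B mB muB0; rewrite nuE//.
  by apply: null_set_integral => //; exact: measurable_funTS.
rewrite -(Radon_Nikodym_change_of_variables numu mA ig).
have mg := measurable_int _ ig.
apply: ae_eq_integral => //.
- apply: emeasurable_funM => //; apply: measurable_funTS.
  by apply: (measurable_int mu); exact: Radon_Nikodym_integrable.
- apply: (eq_measurable_fun (fun x => (EFin \o g) x * (EFin \o p) x)%E) => //.
  by apply: emeasurable_funM => //; exact: measurable_funTS.
under [X in ae_eq _ _ _ X]eq_fun do rewrite EFinM.
apply: ae_eqe_mul2l; apply: integral_ae_eq => //.
- by apply: (integrableS measurableT) => //; exact: Radon_Nikodym_integrable.
- exact: measurable_funTS.
- move=> E EA mE; rewrite -Radon_Nikodym_integral//.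
  exact: nuE.
Qed.

Lemma integrable_density (A : set T) (g : T -> R) : measurable A ->
  nu.-integrable A (EFin \o g) ->
  mu.-integrable A (EFin \o (fun x => g x * p x)).
Proof.
move=> mA ig; have mp := measurable_int _ ip.
have mg := measurable_int _ ig.
have mgp : measurable_fun A (fun x => g x * p x).
  apply: measurable_funM; first exact/measurable_EFinP.
  exact/measurable_funTS/measurable_EFinP.
apply/integrableP; split; first exact/measurable_EFinP.
have := integral_density mA (integrable_norm ig).
have /integrableP[_ +] := ig.
under [in X in _ -> X -> _]eq_integral do rewrite /=.
move=> + h; rewrite /= {}h; congr (_ < _)%E.
by apply: eq_integral => x _ /=; rewrite normrM (ger0_norm (p_ge0 x)).
Qed.

End integral_density.

Section integral_lebesgue_density.
Context (R : realType).
Local Notation mu := (@lebesgue_measure R).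
Variables (nu : probability R R) (p : R -> R).
Hypotheses (ip : mu.-integrable setT (EFin \o p)) (p_ge0 : forall x, 0 <= p x).
Hypothesis nuE : forall A, measurable A ->
  nu A = (\int[mu]_(x in A) (p x)%:E)%E.

(* the Lebesgue measure lives on a copy of R as a measurable type, to which
   [nu] is transported along the identity *)
Let idR : R -> measurableTypeR R := idfun.

#[local] HB.instance Definition _ :=
  @isMeasurableFun.Build _ _ _ _ idR (@measurable_id _ _ setT).

Let nu' := distribution nu idR.

Lemma integral_lebesgue_density (A : set R) (g : R -> R) :
  measurable A -> measurable_fun [set: R] g ->
  nu.-integrable A (EFin \o g) ->
  mu.-integrable A (EFin \o (fun x => g x * p x)) /\
  (\int[nu]_(x in A) (g x)%:E = \int[mu]_(x in A) (g x * p x)%:E)%E.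
Proof.
move=> mA mg ig.
have mEg : measurable_fun [set: measurableTypeR R] (EFin \o g).
  exact/measurable_EFinP.
have midR : measurable_fun [set: R] idR := @measurable_id _ _ setT.
have ig' : nu'.-integrable A (EFin \o g).
  exact: (integrable_pushforward midR mEg ig mA).
have nuE' (B : set (measurableTypeR R)) : measurable B ->
  nu' B = (\int[mu]_(x in B) (p x)%:E)%E by exact: nuE.
split; first exact: (integrable_density ip p_ge0 nuE' mA ig').
rewrite -(integral_density ip nuE' mA ig').
by rewrite (integral_pushforward midR mEg ig mA).
Qed.

End integral_lebesgue_density.

Section positive_random_variable.
Context (R : realType) d (T : measurableType d) (P : probability T R).
Variable X : {RV P >-> R}.
Hypothesis X_gt0 : {ae P, forall w, 0 < X w}.
Local Notation D := (`]0, +oo[%classic : set R).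
Local Notation nu := (distribution P X).

Lemma distribution_gt0C : nu (~` D) = 0%E.
Proof.
have [N [mN N0 XN]] := X_gt0.
apply/eqP; rewrite eq_le measure_ge0 andbT -N0.
change (P (X @^-1` ~` D) <= P N)%E; apply: le_measure; rewrite ?inE//.
  by apply: measurable_funPTI => //; exact: measurableC.
by move=> w /= /negP; rewrite in_itv/= andbT => /negP Xw; apply: XN => /=.
Qed.

Lemma expectation_distribution (g : R -> R) : measurable_fun setT g ->
  nu.-integrable D (EFin \o g) ->
  ('E_P[g \o X] = \int[nu]_(x in D) (g x)%:E)%E.
Proof.
move=> mg ig; pose h := g \_ D.
have mh : measurable_fun setT h.
  by apply/(measurable_restrictT _ _).1 => //; exact: measurable_funTS.
have ih : nu.-integrable setT (EFin \o h).
  by rewrite -restrict_EFin; apply/integrable_restrict => //; rewrite setTI.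
have mgX : measurable_fun setT (g \o X).
  by apply: measurableT_comp => //; exact: measurable_funPT.
have mhX : measurable_fun setT (h \o X).
  by apply: measurableT_comp => //; exact: measurable_funPT.
have ihX : P.-integrable setT (EFin \o h \o X).
  apply/integrableP; split; first exact/measurable_EFinP.
  have /integrableP[_] := ih; rewrite ge0_integral_distribution//.
  by apply: measurableT_comp => //; exact/measurable_EFinP.
rewrite unlock [RHS]integral_mkcond.
transitivity (\int[nu]_x (h x)%:E)%E; last first.
  by apply: eq_integral => x _; rewrite restrict_EFin.
rewrite (integral_distribution (f := EFin \o h))//; last exact/measurable_EFinP.
apply: ae_eq_integral => //; [exact/measurable_EFinP..|].
apply: filterS X_gt0 => w Xw _ /=.
by rewrite /h patchE mem_set//= in_itv/= Xw.
Qed.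

Lemma integrable_distribution (g : R -> R) : measurable_fun setT g ->
  ('E_P[(fun w => `|g (X w)|%R)] < +oo)%E ->
  nu.-integrable D (EFin \o g).
Proof.
rewrite unlock => mg Eg; apply: (integrableS measurableT) => //.
apply/integrableP; split; first exact/measurable_EFinP.
rewrite ge0_integral_distribution//.
by apply: measurableT_comp => //; exact/measurable_EFinP.
Qed.

End positive_random_variable.

(** * The Weibull law satisfies the identity *)

Section integrability.
Variables (R : realType) (lambda k : R).
Local Notation D := (`]0, +oo[%classic : set R).
Local Notation c := (weibull_score lambda k).
Variable nu : {finite_measure set R -> \bar R}.

Lemma measurable_score_term (u : R -> R) : measurable_fun [set: R] u ->
  measurable_fun [set: R] (fun x => x^-1 * c x * u x).
Proof.
move=> mu; apply: measurable_funM => //; apply: measurable_funM.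
  exact: measurable_inv.
exact: measurable_weibull_score.
Qed.

Lemma bounded_integrable (g : R -> R) (M : R) : measurable_fun [set: R] g ->
  (forall x, 0 < x -> `|g x| <= M) -> nu.-integrable D (EFin \o g).
Proof.
move=> mg gM; apply: (@le_integrable _ _ _ _ _ _ _ (EFin \o cst M)) => //.
- exact/measurable_EFinP/measurable_funTS.
- move=> x /=; rewrite in_itv/= andbT => x0.
  by rewrite lee_fin (le_trans (gM _ x0))// ler_norm.
- exact: finite_measure_integrable_cst.
Qed.

Lemma integrable_score_term (u : R -> R) (M : R) : measurable_fun [set: R] u ->
  nu.-integrable D (EFin \o c) ->
  (forall x, 0 < x -> `|u x| <= M * x) ->
  nu.-integrable D (EFin \o (fun x => x^-1 * c x * u x)).
Proof.
move=> mu ic uM.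
have mD : measurable D by [].
apply: (le_integrable mD _ _ (integrableZl mD M ic)).
- apply/measurable_EFinP; apply: measurable_funTS.
  exact: measurable_score_term.
- move=> x /=; rewrite in_itv/= andbT => x0.
  rewrite lee_fin !normrM normfV (gtr0_norm x0) mulrAC.
  rewrite ler_wpM2r// mulrC ler_pdivrMr//.
  by rewrite (le_trans (uM _ x0))// ler_wpM2r ?ler_norm// ltW.
Qed.

Lemma integrable_laplace_kernel (t : R) : 0 <= t ->
  nu.-integrable D (EFin \o (fun x => expR (- t * x))).
Proof.
move=> t0; apply: (@bounded_integrable _ 1); first exact: measurable_expRM.
move=> x x0; rewrite ger0_norm ?expR_ge0// -expR0 ler_expR mulNr oppr_le0.
by rewrite mulr_ge0// ltW.
Qed.

Lemma integrable_onem_laplace_kernel (t : R) : 0 <= t ->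
  nu.-integrable D (EFin \o c) ->
  nu.-integrable D (EFin \o (fun x => x^-1 * c x * (1 - expR (- t * x)))).
Proof.
move=> t0 ic; apply: (@integrable_score_term _ t) => //.
  by apply: measurable_funB => //; exact: measurable_expRM.
move=> x x0; have /andP[h1 h2] := onem_expRN_itv t0 (ltW x0).
by rewrite ger0_norm.
Qed.

End integrability.

Section weibull_identity.
Variables (R : realType) (lambda k : R).
Hypotheses (lambda_gt0 : 0 < lambda) (k_gt0 : 0 < k).
Local Notation D := (`]0, +oo[%classic : set R).
Local Notation mu := (@lebesgue_measure R).
Local Notation f := (weibull_pdf lambda k).
Local Notation y := (weibull_hazard lambda k).
Local Notation c := (weibull_score lambda k).
Local Notation q := (weibull_quantile lambda k).

Lemma integrable_weibull_pdf : mu.-integrable setT (EFin \o f).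
Proof.
have mf := measurable_weibull_pdf lambda k.
apply/integrableP; split; first exact/measurable_EFinP.
apply: (@le_lt_trans _ _ 1%E); last exact: ltry.
rewrite -(integral_weibull_pdf lambda_gt0 k_gt0) [leRHS]integral_mkcond.
apply: ge0_le_integral => //.
- by apply: measurableT_comp => //; exact/measurable_EFinP.
- apply/(measurable_restrictT _ _).1 => //.
  by apply: measurable_funTS; exact/measurable_EFinP.
- move=> x _; rewrite patchE; case: ifPn => [_|].
    by rewrite /= ger0_norm// weibull_pdf_ge0.
  rewrite notin_setE/= in_itv/= andbT => /negP; rewrite -leNgt => x0.
  by rewrite weibull_pdf_le0// normr0.
Qed.

(** The boundary term of the integration by parts. *)
Let G (t x : R) := f x * (1 - expR (- t * x)).

Let G_itv (t s : R) : 0 < t -> 0 < s ->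
  0 <= G t (q s) <= t * k * (s * expR (- s)).
Proof.
move=> t0 s0; have qs : 0 < q s by exact: weibull_quantile_gt0.
have /andP[h1 h2] := onem_expRN_itv (ltW t0) (ltW qs).
rewrite /G mulr_ge0 ?weibull_pdf_ge0//=.
rewrite weibull_pdfE// weibull_quantileK ?(ltW s0)//.
have -> : t * k * (s * expR (- s)) = k * s * expR (- s) / q s * (t * q s).
  by field; rewrite gt_eqF.
rewrite ler_wpM2l// divr_ge0 ?(ltW qs)// !mulr_ge0 ?expR_ge0// ltW//.
Qed.

Let cvg_G (t : R) : 0 < t ->
  G t (q n.+2%:R) - G t (q n.+1%:R^-1) @[n --> \oo] --> 0.
Proof.
move=> t0; pose K := 4 * t * k.
have hK : (K * harmonic n) @[n --> \oo] --> 0.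
  rewrite -[X in _ --> X](mulr0 K).
  by apply: cvgM; [exact: cvg_cst|exact: cvg_harmonic].
have tk : 0 < t * k by rewrite mulr_gt0.
(* the bound [t k s exp (- s)] is at most [t k s] for [s = 1 / (n + 1)], and
   at most [4 t k / s] for [s = n + 2] *)
apply: (@squeeze_cvgr _ _ _ _ (fun n => - (K * harmonic n))
  (fun n => K * harmonic n)) => //.
  apply: nearW => n; rewrite /harmonic.
  have n1 : 0 < n.+1%:R :> R by rewrite ltr0n.
  have n2 : 0 < n.+2%:R :> R by rewrite ltr0n.
  have n1V : 0 < n.+1%:R^-1 :> R by rewrite invr_gt0.
  have /andP[h1 h2] := G_itv t0 n2.
  have /andP[h3 h4] := G_itv t0 n1V.
  have h5 := mulr_expRN_le n2.
  have h6 : n.+1%:R^-1 * expR (- n.+1%:R^-1) <= n.+1%:R^-1 :> R.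
    by rewrite ger_pMr// -expR0 ler_expR oppr_le0 ltW.
  have h7 : n.+2%:R^-1 <= n.+1%:R^-1 :> R.
    by rewrite lef_pV2 ?posrE// ler_nat.
  have h8 : t * k * (n.+2%:R * expR (- n.+2%:R)) <= K * n.+1%:R^-1.
    rewrite (_ : K * _ = t * k * (4 * n.+1%:R^-1)); last by rewrite /K; ring.
    rewrite ler_wpM2l ?(ltW tk)// (le_trans h5)// ler_wpM2l//.
  have h9 : t * k * (n.+1%:R^-1 * expR (- n.+1%:R^-1)) <= K * n.+1%:R^-1.
    rewrite (_ : K * _ = t * k * (4 * n.+1%:R^-1)); last by rewrite /K; ring.
    rewrite ler_wpM2l ?(ltW tk)// (le_trans h6)//.
    by rewrite ler_peMl ?(ltW n1V)// ler1n.
  move: (le_trans h2 h8) (le_trans h4 h9) h1 h3.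
  move: (G t _) (G t _) (K * _) => a b e; clear => ae be a0 b0.
  by apply/andP; split; lra.
by rewrite -oppr0; apply: cvgN.
Qed.

(** The difference of the two integrands, times the density, is the
    derivative of the boundary term. *)
Lemma weibull_identity (nu : probability R R) (t : R) :
  (forall A, measurable A -> nu A = weibull_prob lambda k A) ->
  nu.-integrable D (EFin \o c) -> 0 < t ->
  (t%:E * \int[nu]_(x in D) (expR (- t * x))%:E =
   \int[nu]_(x in D) (x^-1 * c x * (1 - expR (- t * x)))%:E)%E.
Proof.
move=> nuW ic t0.
have mD : measurable D by [].
pose g x := t * expR (- t * x) - x^-1 * c x * (1 - expR (- t * x)).
have ie := integrable_laplace_kernel nu (ltW t0).
have iS := integrable_onem_laplace_kernel (ltW t0) ic.
have ite := integrableZl mD t ie.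
have ig : nu.-integrable D (EFin \o g) by exact: (integrableB mD ite iS).
suff g0 : (\int[nu]_(x in D) (g x)%:E = 0)%E.
  rewrite -integralZl//.
  have fS := integrable_fin_num mD iS.
  have := integralB mD ite iS; rewrite [X in X = _]g0 => /esym h.
  by rewrite -[LHS](subeK _ fS) h add0e.
have mg : measurable_fun [set: R] g.
  apply: measurable_funB.
    by apply: measurable_funM => //; exact: measurable_expRM.
  apply: measurable_score_term.
  by apply: measurable_funB => //; exact: measurable_expRM.
have f_ge0 : forall x, 0 <= f x by exact: weibull_pdf_ge0.
have [igf ->] :=
  integral_lebesgue_density integrable_weibull_pdf f_ge0 nuW mD mg ig.
pose A n := weibull_itv lambda k n.
have dG (x : R) : 0 < x -> is_derive x 1 (G t) (g x * f x).
  move=> x0; have df := is_derive_weibull_pdf lambda_gt0 k_gt0 x0.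
  have h := is_deriveM df (is_derive_onem_expRN t x).
  apply: is_derive_ext h _ _ => //.
  by rewrite /g /GRing.scale/=; field; rewrite gt_eqF.
have cgf (x : R) : 0 < x -> {for x, continuous (fun z => g z * f z)}.
  move=> x0.
  have ce : {for x, continuous (fun z : R => expR (- t * z))}.
    apply: continuous_comp; last exact: continuous_expR.
    exact: mulrl_continuous.
  apply: cvgM; last exact: continuous_weibull_pdf.
  apply: cvgB; first by apply: cvgM; [exact: cvg_cst|exact: ce].
  apply: cvgM; last by apply: cvgB; [exact: cvg_cst|exact: ce].
  apply: cvgM; last exact: continuous_weibull_score.
  by apply: inv_continuous; rewrite gt_eqF.
have mgf := measurable_int _ igf.
have AD n : [set` A n] `<=` D.
  by move=> x /(weibull_itv_gt0 lambda_gt0) x0 /=; rewrite in_itv/= x0.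
pose h : R -> \bar R := EFin \o (fun x => g x * f x).
pose F_ n := h \_ [set` A n].
have mF n : measurable_fun D (F_ n).
  by apply/(measurable_restrict _ _ _).1 => //; apply: measurable_funS mgf.
have F_cvg : {ae lebesgue_measure, forall x, D x ->
    F_ ^~ x @ \oo --> h x}.
  apply: aeW => x /=; rewrite in_itv/= andbT => x0.
  apply: cvg_near_cst; have := near_weibull_itv lambda_gt0 k_gt0 x0.
  by apply: filterS => n xA; rewrite /F_ patchE mem_set.
have F_le : {ae lebesgue_measure, forall x n, D x ->
    (`|F_ n x| <= (abse \o h) x)%E}.
  apply: aeW => x n Dx; rewrite /F_ patchE; case: ifPn => // _.
  by rewrite abse0 abse_ge0.
have [_ _ dct] := @dominated_convergence _ (measurableTypeR R) R
  lebesgue_measure D mD F_ _ _ mF mgf F_cvg (integrable_abse igf) F_le.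
apply: (cvg_unique _ dct) => //.
have E n : (\int[mu]_(x in D) F_ n x =
    (G t (q n.+2%:R) - G t (q n.+1%:R^-1))%:E)%E.
  rewrite /F_ -integral_mkcondr setIidr//.
  by rewrite (integral_weibull_itv lambda_gt0 k_gt0 n cgf dG) EFinB.
rewrite /= (_ : (fun n => _) =
    fun n => (G t (q n.+2%:R) - G t (q n.+1%:R^-1))%:E).
  apply: cvg_EFin; [exact: nearW|exact: cvg_G].
by apply/funext => n; exact: E.
Qed.

End weibull_identity.

(** * The identity determines the law *)

Section stein_pairs.
Variables (R : realType) (lambda k : R).
Local Notation D := (`]0, +oo[%classic : set R).
Local Notation c := (weibull_score lambda k).
Variable nu : probability R R.
Hypothesis ic : nu.-integrable D (EFin \o c).

Let mD : measurable D. Proof. by []. Qed.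

Let residual (g u : R -> R) : R -> R := fun x => g x - x^-1 * c x * u x.

(** [stein_fun g]: with [u] the primitive of [g] vanishing at [0], Stein's
    identity [E (u'(X)) = E (weibull_score X / X * u X)] holds for [X] of law
    [nu], in the form that the difference of the two sides is integrable on
    the half-line with integral [0]. *)
Definition stein_fun (g : R -> R) : Prop := exists u : R -> R,
  [/\ u 0 = 0, forall x : R, is_derive x 1 u (g x),
      nu.-integrable D (EFin \o (fun x => g x - x^-1 * c x * u x)) &
      \int[nu]_(x in D) (g x - x^-1 * c x * u x) = 0].

Lemma stein_fun_lin (g h : R -> R) (a : R) : stein_fun g -> stein_fun h ->
  stein_fun (fun x => g x + a * h x).
Proof.
move=> [u [u0 du iu Iu]] [v [v0 dv iv Iv]].
exists (fun x => u x + a * v x).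
have E x : g x + a * h x - x^-1 * c x * (u x + a * v x) =
    residual g u x + a * residual h v x by rewrite /residual; ring.
have iav : nu.-integrable D (EFin \o (fun x => a * residual h v x)).
  exact: (integrableZl mD a iv).
split; first by rewrite u0 v0 mulr0 addr0.
- move=> x; have h1 := is_deriveD (du x) (is_deriveZ a (dv x)).
  exact: is_derive_ext h1 _ _.
- by rewrite (funext E); exact: (integrableD mD iu iav).
- under eq_Rintegral do rewrite E.
  by rewrite RintegralD// RintegralZl// Iu Iv mulr0 addr0.
Qed.

Lemma stein_fun0 : stein_fun (fun=> 0).
Proof.
exists (fun=> 0); split => //.
- by move=> x; exact: is_derive_cst.
- apply: (eq_integrable mD (cst 0%E)); last exact: integrable0.
  by move=> x _ /=; rewrite mulr0 subr0.
- under eq_Rintegral do rewrite mulr0 subr0.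
  by rewrite /Rintegral integral0.
Qed.

Hypothesis identity : forall t : R, 0 < t ->
  (t%:E * \int[nu]_(x in D) (expR (- t * x))%:E =
   \int[nu]_(x in D) (x^-1 * c x * (1 - expR (- t * x)))%:E)%E.

Lemma stein_fun_expR (t : R) : 0 < t -> stein_fun (fun x => t * expR (- t * x)).
Proof.
move=> t0; exists (fun x => 1 - expR (- t * x)).
have ie := integrable_laplace_kernel nu (ltW t0).
have iS := integrable_onem_laplace_kernel (ltW t0) ic.
have ite := integrableZl mD t ie.
split.
- by rewrite mulr0 expR0 subrr.
- exact: is_derive_onem_expRN.
- exact: (integrableB mD ite iS).
- rewrite RintegralB// RintegralZl// /Rintegral -identity// fineM ?subrr//.
  exact: integrable_fin_num.
Qed.

Lemma stein_fun_poly (p : {poly R}) :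
  stein_fun (fun x => expR (- x) * p.[expR (- x)]).
Proof.
pose h n (x : R) :=
  \sum_(i < n) p`_i / i.+1%:R * (i.+1%:R * expR (- i.+1%:R * x)).
have hS n : stein_fun (h n).
  elim: n => [|n IH].
    have -> : h 0 = fun=> 0 by apply/funext => x; rewrite /h big_ord0.
    exact: stein_fun0.
  have -> : h n.+1 = fun x => h n x +
      p`_n / n.+1%:R * (n.+1%:R * expR (- n.+1%:R * x)).
    by apply/funext => x; rewrite /h big_ord_recr.
  by apply: stein_fun_lin IH _; apply: stein_fun_expR; rewrite ltr0n.
have -> : (fun x => expR (- x) * p.[expR (- x)]) = h (size p); last exact: hS.
apply/funext => x; rewrite horner_coef mulr_sumr; apply: eq_bigr => i _.
rewrite [in RHS]mulrA divfK ?pnatr_eq0// mulrCA; congr (_ * _).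
by rewrite mulNr -mulrN expRM_natl exprS.
Qed.

(** The support condition makes [G y = g (- ln y) / y] continuous on [R], so
    that [g x = exp (- x) G (exp (- x))] is uniformly close to
    [exp (- x) p (exp (- x))] for a polynomial [p]. *)
Lemma stein_fun_continuous (g u : R -> R) (a b : R) : 0 < a ->
  continuous g ->
  (forall x, x <= a -> g x = 0) -> (forall x, b <= x -> g x = 0) ->
  u 0 = 0 -> (forall x : R, is_derive x 1 u (g x)) ->
  \int[nu]_(x in D) (g x - x^-1 * c x * u x) = 0.
Proof.
move=> a0 cg ga gb u0 du.
pose G (z : R) : R := g (- ln z) / z.
have cG : continuous G.
  move=> z; have [z0|z0] := ltP 0 z.
    apply: cvgM; last by apply: inv_continuous; rewrite gt_eqF.
    apply: (@continuous_comp _ _ _ (fun z => - ln z) g); last exact: cg.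
    by apply: cvgN; exact: continuous_ln.
  have G0 : \forall s \near z, G s = 0.
    near=> s; rewrite /G.
    have [s0|s0] := ltP 0 s; last first.
      by rewrite ln0// oppr0 ga ?mul0r// ltW.
    rewrite gb ?mul0r// lerNr -(expRK (- b)) ler_ln ?posrE ?expR_gt0//.
    rewrite ltW//; near: s; apply: lt_nbhsl.
    by rewrite (le_lt_trans z0)// expR_gt0.
  rewrite /continuous_at (nbhs_singleton G0); exact: cvg_near_cst.
have cu : continuous u by move=> x; exact: is_derive_continuous (du x).
have mgu : measurable_fun [set: R] (residual g u).
  apply: measurable_funB; first exact: continuous_measurable_fun.
  by apply: measurable_score_term; exact: continuous_measurable_fun.
pose B (x : R) : R := 1 + `|c x|.
have iB : nu.-integrable D (EFin \o B).
  have i1 : nu.-integrable D (EFin \o cst 1).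
    exact: finite_measure_integrable_cst.
  exact: (integrableD mD i1 (integrable_norm ic)).
pose I := \int[nu]_(x in D) residual g u x.
have key (e : R) : 0 < e -> `|I| <= e * \int[nu]_(x in D) B x.
  move=> e0; have [p pG] := weierstrass_approximation cG e0.
  pose h (x : R) : R := expR (- x) * p.[expR (- x)].
  have [v [v0 dv iv Iv]] : stein_fun h := stein_fun_poly p.
  have gh (x : R) : 0 <= x -> `|g x - h x| <= e.
    move=> x0; have ex : 0 < expR (- x) by exact: expR_gt0.
    have -> : g x - h x = expR (- x) * (G (expR (- x)) - p.[expR (- x)]).
      by rewrite /G /h expRK opprK; field; rewrite gt_eqF.
    have ex1 : expR (- x) <= 1 by rewrite -expR0 ler_expR oppr_le0.
    rewrite normrM gtr0_norm//.
    have := pG (expR (- x)); rewrite ex1 ltW// => /(_ isT) h1.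
    by rewrite -[leRHS]mul1r ler_pM// ltW.
  have uv (x : R) : 0 < x -> `|u x - v x| <= e * x.
    move=> x0; have d (z : R) : is_derive z 1 (u - v) (g z - h z).
      exact: is_deriveB.
    have := @MVT _ (u - v) (fun z => g z - h z) 0 x x0 (fun z _ => d z).
    case.
      by apply: continuous_subspaceT => z; exact: is_derive_continuous (d z).
    move=> s; rewrite in_itv/= => /andP[s0 sx].
    rewrite !fctE u0 v0 !subr0 => ->; rewrite normrM (gtr0_norm x0).
    by rewrite ler_pM2r// gh// ltW.
  pose r x := residual g u x - residual h v x.
  have rB (x : R) : 0 < x -> `|r x| <= e * B x.
    move=> x0; have -> : r x = (g x - h x) - x^-1 * c x * (u x - v x).
      by rewrite /r /residual; ring.
    rewrite (_ : e * B x = e + e * `|c x|); last by rewrite /B; ring.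
    rewrite (le_trans (ler_normB _ _))// lerD ?gh ?(ltW x0)//.
    rewrite !normrM normfV (gtr0_norm x0).
    rewrite (_ : e * `|c x| = x^-1 * `|c x| * (e * x)).
      by rewrite ler_wpM2l ?uv// mulr_ge0// invr_ge0 ltW.
    by field; rewrite gt_eqF.
  have ieB := integrableZl mD e iB.
  have ir : nu.-integrable D (EFin \o r).
    apply: (le_integrable mD _ _ ieB).
      apply/measurable_EFinP; apply: measurable_funB.
        exact: measurable_funTS.
      by apply/measurable_EFinP; exact: measurable_int iv.
    move=> x; rewrite /= in_itv/= andbT => x0.
    by rewrite lee_fin (le_trans (rB _ x0))// ler_norm.
  have -> : I = \int[nu]_(x in D) r x.
    have E x : residual g u x = r x + residual h v x by rewrite /r subrK.
    rewrite /I; under eq_Rintegral do rewrite E.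
    by rewrite RintegralD// Iv addr0.
  rewrite (le_trans (le_normr_Rintegral mD ir))// -RintegralZl//.
  apply: le_Rintegral => //; first exact: integrable_norm ir.
  by move=> x /=; rewrite in_itv/= andbT => /rB.
pose M := \int[nu]_(x in D) B x.
have M0 : 0 <= M by apply: Rintegral_ge0 => x _; rewrite addr_ge0.
apply/eqP; rewrite -normr_eq0 eq_le normr_ge0 andbT -/I.
apply/ler_addgt0Pl => e e0; rewrite addr0.
have M1 : 0 < M + 1 by rewrite ltr_pwDr.
have := key (e / (M + 1)) (divr_gt0 e0 M1) => /le_trans; apply.
rewrite -/M mulrAC ler_pdivrMr// ler_wpM2l ?ltW//; lra.
Unshelve. all: by end_near. Qed.

End stein_pairs.

Section characterization.
Variables (R : realType) (lambda k : R).
Hypotheses (lambda_gt0 : 0 < lambda) (k_gt0 : 0 < k).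
Local Notation D := (`]0, +oo[%classic : set R).
Local Notation mu := (@lebesgue_measure R).
Local Notation f := (weibull_pdf lambda k).
Local Notation c := (weibull_score lambda k).
Variable nu : probability R R.
Hypothesis nuC : nu (~` D) = 0%E.
Hypothesis ic : nu.-integrable D (EFin \o c).
Hypothesis identity : forall t : R, 0 < t ->
  (t%:E * \int[nu]_(x in D) (expR (- t * x))%:E =
   \int[nu]_(x in D) (x^-1 * c x * (1 - expR (- t * x)))%:E)%E.

Let mD : measurable D. Proof. by []. Qed.
Let mDl : measurable (D : set (measurableTypeR R)). Proof. by []. Qed.

(** Stein's identity for [u = w / f], [w] the primitive of [F]. *)
Lemma integral_div_weibull_pdf (F : R -> R) (a b : R) : 0 < a ->
  continuous F ->
  (forall x, x <= a -> F x = 0) -> (forall x, b <= x -> F x = 0) ->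
  \int[mu]_(x in D) F x = 0 ->
  \int[nu]_(x in D) (F x / f x) = 0.
Proof.
move=> a0 cF Fa Fb IF.
pose w (x : R) : R := \int[mu]_(s in `[0, x]) F s.
have iF (x : R) : mu.-integrable `[0, x] (EFin \o F).
  apply: continuous_compact_integrable; first exact: segment_compact.
  exact: continuous_subspaceT.
have wa (x : R) : x <= a -> w x = 0.
  move=> xa; rewrite /w -[RHS](@Rintegral_set0 _ _ _ mu F).
  rewrite [LHS]Rintegral_mkcond [RHS]Rintegral_mkcond; congr Rintegral.
  apply/funext => s; rewrite !patchE in_set0; case: ifPn => //.
  rewrite inE/= in_itv/= => /andP[_ sx]; apply: Fa; exact: le_trans xa.
have wb (x : R) : b <= x -> w x = 0.
  move=> bx; rewrite /w -[RHS]IF.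
  rewrite [LHS]Rintegral_mkcond [RHS]Rintegral_mkcond; congr Rintegral.
  apply/funext => s; rewrite !patchE; have [s0|s0] := leP s 0.
    by rewrite Fa ?(le_trans s0 (ltW a0))//; do 2 case: ifP.
  rewrite [X in _ = if X then _ else _]mem_set/=; last by rewrite in_itv/= s0.
  have [sx|sx] := leP s x; first by rewrite mem_set//= in_itv/= (ltW s0).
  by rewrite Fb ?(le_trans bx (ltW sx))//; case: ifP.
have dw (x : R) : 0 < x -> is_derive x 1 w (F x).
  move=> x0; have xx : x < x + 1 by rewrite ltrDl.
  have [h1 h2] := continuous_FTC1_closed xx (iF (x + 1)) x0 (cF x).
  by rewrite -h2 derive1E; exact: DeriveDef.
pose u (x : R) : R := w x / f x.
pose g (x : R) : R := F x / f x + c x / x * u x.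
have fn0 (x : R) : 0 < x -> f x != 0.
  by move=> x0; rewrite gt_eqF// weibull_pdf_gt0.
have cu (x : R) : 0 < x -> {for x, continuous (fun s => (f s)^-1)}.
  move=> x0; apply: cvgV; first exact: fn0.
  exact: continuous_weibull_pdf.
have cg : continuous g.
  apply: (continuous_gt0_lt a0) => [x x0|x xa].
    have cw := is_derive_continuous (dw x x0).
    apply: cvgD; first by apply: cvgM; [exact: cF|exact: cu].
    apply: cvgM; last by apply: cvgM; [exact: cw|exact: cu].
    apply: cvgM; first exact: continuous_weibull_score.
    by apply: inv_continuous; rewrite gt_eqF.
  by rewrite /g /u Fa// wa// !mul0r mulr0 addr0.
have ga (x : R) : x <= a -> g x = 0.
  by move=> xa; rewrite /g /u Fa// wa// !mul0r mulr0 addr0.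
have gb (x : R) : b <= x -> g x = 0.
  by move=> xb; rewrite /g /u Fb// wb// !mul0r mulr0 addr0.
have du (x : R) : is_derive x 1 u (g x).
  have [x0|x0] := ltP 0 x.
    have df := is_derive_weibull_pdf lambda_gt0 k_gt0 x0.
    have h := is_deriveM (dw x x0) (is_deriveV (fn0 x x0) df).
    apply: is_derive_ext h _ _ => //.
    rewrite /GRing.scale/= /g /u; field.
    by rewrite fn0// gt_eqF.
  have xa : x < a by exact: le_lt_trans x0 a0.
  rewrite ga ?ltW//.
  apply: (@near_eq_is_derive _ _ _ (cst 0 : R -> R)).
    near=> s; rewrite /u wa ?mul0r// ltW//; near: s; exact: lt_nbhsl.
have u0 : u 0 = 0 by rewrite /u wa ?mul0r// ltW.
(* on [D], [F / f = u' - (c / x) u] *)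
rewrite -[RHS](stein_fun_continuous ic identity a0 cg ga gb u0 du).
apply: eq_Rintegral => x _.
rewrite /g; ring.
Unshelve. all: by end_near. Qed.

Let E (phi : R -> R) := \int[nu]_(x in D) phi x.
Let J (phi : R -> R) := \int[mu]_(x in D) (phi x * f x).

Let ifD : mu.-integrable D (EFin \o f).
Proof.
by apply: (integrableS measurableT) => //; exact: integrable_weibull_pdf.
Qed.

(** Apply [integral_div_weibull_pdf] to the combination of [phi * f] and
    [psi * f] whose integral is [0]. *)
Lemma test_function_proportional (phi psi : R -> R) (a b : R) : 0 < a ->
  continuous phi -> continuous psi ->
  (forall x, 0 <= phi x <= 1) -> (forall x, 0 <= psi x <= 1) ->
  (forall x, x <= a -> phi x = 0) -> (forall x, x <= a -> psi x = 0) ->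
  (forall x, b <= x -> phi x = 0) -> (forall x, b <= x -> psi x = 0) ->
  E phi * J psi = E psi * J phi.
Proof.
move=> a0 cphi cpsi phi01 psi01 phia psia phib psib.
have inu (h : R -> R) : continuous h -> (forall x, 0 <= h x <= 1) ->
    nu.-integrable D (EFin \o h).
  move=> ch h01; apply: (@bounded_integrable _ nu _ 1).
    exact: continuous_measurable_fun.
  by move=> x _; have /andP[h0 h1] := h01 x; rewrite ger0_norm.
have imu (h : R -> R) : continuous h -> (forall x, 0 <= h x <= 1) ->
    mu.-integrable D (EFin \o (fun x => h x * f x)).
  move=> ch h01; apply: (le_integrable _ _ _ ifD) => //.
    apply/measurable_EFinP; apply: measurable_funM.
      by apply: measurable_funTS; exact: continuous_measurable_fun.
    by apply: measurable_funTS; exact: measurable_weibull_pdf.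
  move=> x _; have /andP[h0 h1] := h01 x.
  rewrite lee_fin normrM (ger0_norm h0) -[leRHS]mul1r.
  by rewrite ler_wpM2r.
pose F (x : R) : R := J psi * (phi x * f x) - J phi * (psi x * f x).
have cF : continuous F.
  apply: (continuous_gt0_lt a0) => [x x0|x xa].
    have cf := continuous_weibull_pdf lambda_gt0 k_gt0 x0.
    apply: cvgB; apply: cvgM; [exact: cvg_cst| |exact: cvg_cst|].
      by apply: cvgM; [exact: cphi|exact: cf].
    by apply: cvgM; [exact: cpsi|exact: cf].
  by rewrite /F phia// psia// !mul0r !mulr0 subrr.
have Fa x : x <= a -> F x = 0.
  by move=> xa; rewrite /F phia// psia// !mul0r !mulr0 subrr.
have Fb x : b <= x -> F x = 0.
  by move=> xb; rewrite /F phib// psib// !mul0r !mulr0 subrr.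
have iphi := imu _ cphi phi01; have ipsi := imu _ cpsi psi01.
have iJphi := integrableZl mDl (J psi) iphi.
have iJpsi := integrableZl mDl (J phi) ipsi.
have IF : \int[mu]_(x in D) F x = 0.
  by rewrite RintegralB// !RintegralZl// -/(J phi) -/(J psi) mulrC subrr.
have := integral_div_weibull_pdf a0 cF Fa Fb IF.
rewrite (@eq_Rintegral _ _ _ _ _ (fun x => J psi * phi x - J phi * psi x)).
  have jphi := inu _ cphi phi01; have jpsi := inu _ cpsi psi01.
  have jJphi := integrableZl mD (J psi) jphi.
  have jJpsi := integrableZl mD (J phi) jpsi.
  rewrite RintegralB// !RintegralZl// -/(E phi) -/(E psi) => /eqP.
  by rewrite subr_eq0 => /eqP h; rewrite mulrC h mulrC.
move=> x; rewrite inE/= in_itv/= andbT => x0.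
by rewrite /F; field; rewrite gt_eqF// weibull_pdf_gt0.
Qed.

(** A continuous trapezoid tending, as [n] grows, to the indicator function
    of the open interval between [0] and [b], and vanishing near [0]. *)
Let trapezoid (n : nat) (b x : R) : R :=
  Num.max 0 (Num.min 1 (n.+1%:R * Num.min (x - n.+1%:R^-1) (b - x))).

Let trapezoid_itv n b x : 0 <= trapezoid n b x <= 1.
Proof. by rewrite /trapezoid le_max lexx/= ge_max ler01/= ge_min lexx. Qed.

Let continuous_trapezoid n b : continuous (trapezoid n b).
Proof.
move=> x.
have h1 : {for x, continuous (fun z : R => z - n.+1%:R^-1)}.
  by apply: cvgB; [exact: cvg_id|exact: cvg_cst].
have h2 : {for x, continuous (fun z : R => b - z)}.
  by apply: cvgB; [exact: cvg_cst|exact: cvg_id].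
have h3 : {for x, continuous
    (fun z : R => n.+1%:R * Num.min (z - n.+1%:R^-1) (b - z))}.
  by apply: cvgM; [exact: cvg_cst|exact: (continuous_min h1 h2)].
have c0 : {for x, continuous (cst (0 : R) : R -> R)} by exact: cvg_cst.
have c1 : {for x, continuous (cst (1 : R) : R -> R)} by exact: cvg_cst.
exact: (continuous_max c0 (continuous_min c1 h3)).
Qed.

Let trapezoid0 n b x : x <= n.+1%:R^-1 \/ b <= x -> trapezoid n b x = 0.
Proof.
move=> h; apply/max_idPl; rewrite ge_min; apply/orP; right.
rewrite pmulr_rle0 ?ltr0n// ge_min !subr_le0.
by case: h => ->; rewrite ?orbT.
Qed.

Let trapezoid1 n b x :
  x^-1 * 2 <= n.+1%:R -> 0 < x -> 1 <= n.+1%:R * (b - x) ->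
  trapezoid n b x = 1.
Proof.
move=> xn x0 bx; have n0 : 0 < n.+1%:R :> R by rewrite ltr0n.
have h : 1 <= n.+1%:R * (x - n.+1%:R^-1).
  rewrite mulrBr divff ?gt_eqF// lerBrDr -[1 + 1]/2%:R.
  by rewrite -ler_pdivrMr// mulrC.
have h2 : 1 <= n.+1%:R * Num.min (x - n.+1%:R^-1) (b - x).
  by rewrite minEle; case: ifP.
by rewrite /trapezoid (min_l h2) max_r.
Qed.

(** Passing to the limit against a density [rho]. *)
Let cvg_indicator d (T : measurableType d) (m : {measure set T -> \bar R})
    (A S : set T) (rho : T -> R) (phi : nat -> T -> R) :
  measurable A -> measurable S -> m.-integrable A (EFin \o rho) ->
  (forall n, measurable_fun A (phi n)) ->
  (forall n x, 0 <= phi n x <= 1) ->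
  (forall x, A x -> \forall n \near \oo, phi n x = (x \in S)%:R) ->
  \int[m]_(x in A) (phi n x * rho x) @[n --> \oo] -->
  fine (\int[m]_(x in A `&` S) (rho x)%:E)%E.
Proof.
move=> mA mS irho mphi phi01 phiS.
have mrho : measurable_fun A rho.
  exact/measurable_EFinP/(measurable_int _ irho).
pose h : T -> \bar R := (EFin \o rho) \_ S.
have mh : measurable_fun A h.
  apply/(measurable_restrict _ _ _).1 => //.
  exact: measurable_funS (measurable_int _ irho).
have mF n : measurable_fun A (EFin \o (fun x => phi n x * rho x)).
  by apply/measurable_EFinP; exact: measurable_funM.
have F_cvg : {ae m, forall x, A x ->
    (fun n => (EFin \o (fun x => phi n x * rho x)) x) @ \oo --> h x}.
  apply: aeW => x Ax; apply: cvg_near_cst.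
  apply: filterS (phiS x Ax) => n /= ->.
  by rewrite /h patchE; case: ifP => _; rewrite ?mul1r ?mul0r.
have F_le : {ae m, forall x n, A x ->
    (`|(EFin \o (fun x => (phi n x * rho x)%R)) x| <=
     (abse \o (EFin \o rho)) x)%E}.
  apply: aeW => x n _ /=; have /andP[p0 p1] := phi01 n x.
  by rewrite lee_fin normrM (ger0_norm p0) ler_piMl.
have [ih _ dct] :=
  dominated_convergence mA mF mh F_cvg (integrable_abse irho) F_le.
rewrite integral_mkcondr.
apply: fine_cvg; rewrite fineK; first exact: dct.
exact: integrable_fin_num ih.
Qed.

(** One test function tends to the indicator function of the ray, the other
    to [1], whose integrals are [1] for both laws. *)
Lemma distribution_ray (b : R) :
  nu `]-oo, b[%classic = weibull_prob lambda k `]-oo, b[%classic.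
Proof.
set S := `]-oo, b[%classic; have mS : measurable S by exact: measurable_itv.
have mSl : measurable (S : set (measurableTypeR R)) by exact: measurable_itv.
have nuD (A : set R) : measurable A -> nu A = nu (D `&` A).
  move=> mA; have mDC : measurable (~` D) by exact: measurableC.
  have nuDC : nu (~` D `&` A) = 0%E.
    apply/eqP; rewrite eq_le measure_ge0 andbT -nuC le_measure ?inE//.
    exact: measurableI.
  rewrite -[in LHS](setTI A) -(setUv D) setIUl measureU//.
  - by rewrite [X in (_ + X)%E](_ : _ = 0%E) ?adde0//; exact: nuDC.
  - exact: measurableI.
  - exact: measurableI.
  - by rewrite setIACA setICr set0I.
have [b0|b0] := leP b 0.
  have SD : S `&` D = set0.
    apply/seteqP; split => // x [] /=; rewrite !in_itv/= andbT => xb x0.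
    by move: (lt_trans x0 xb); rewrite ltNge b0.
  rewrite nuD// setIC SD measure0 weibull_probI// SD.
  by rewrite /weibull_prob integral_set0.
pose phi n := trapezoid n b.
pose psi n := trapezoid n (b + n.+1%:R).
have phiE x : D x -> \forall n \near \oo, phi n x = (x \in S)%:R.
  rewrite /= in_itv/= andbT => x0; have [xb|bx] := ltP x b; last first.
    apply: nearW => n.
    rewrite memNset/=; last by rewrite /S /= in_itv/= ltNge bx.
    by apply: trapezoid0; right.
  rewrite mem_set/=; last by rewrite /S /= in_itv/=.
  have h1 : \forall n \near \oo, x^-1 * 2 <= n%:R by exact: nbhs_infty_ger.
  have h2 : \forall n \near \oo, (b - x)^-1 <= n%:R by exact: nbhs_infty_ger.
  near=> n; have nn : n%:R <= n.+1%:R :> R by rewrite ler_nat.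
  apply: trapezoid1 => //; first by apply: le_trans nn; near: n.
  rewrite -ler_pdivrMr ?subr_gt0// mul1r.
  by apply: le_trans nn; near: n.
have psiE x : D x -> \forall n \near \oo, psi n x = (x \in [set: R])%:R.
  rewrite /= in_itv/= andbT => x0; rewrite in_setT.
  have h1 : \forall n \near \oo, x^-1 * 2 <= n%:R by exact: nbhs_infty_ger.
  have h2 : \forall n \near \oo, x <= n%:R by exact: nbhs_infty_ger.
  near=> n; have nn : n%:R + 1 = n.+1%:R :> R by rewrite natr1.
  apply: trapezoid1 => //.
    by rewrite -nn; apply: (@le_trans _ _ n%:R); [near: n|rewrite lerDl].
  have xn : x <= n%:R by near: n.
  have n0 : 0 <= n%:R :> R by [].
  by rewrite -nn; nra.
have eqn n : E (phi n) * J (psi n) = E (psi n) * J (phi n).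
  have n0 : 0 < n.+1%:R^-1 :> R by rewrite invr_gt0 ltr0n.
  apply: (@test_function_proportional _ _ n.+1%:R^-1 (b + n.+1%:R)) => //;
    try exact: continuous_trapezoid; try exact: trapezoid_itv.
  - by move=> x h; apply: trapezoid0; left.
  - by move=> x h; apply: trapezoid0; left.
  - by move=> x h; apply: trapezoid0; right; rewrite (le_trans _ h)// lerDl.
  - by move=> x h; apply: trapezoid0; right.
have mtr n d : measurable_fun D (trapezoid n d).
  by apply: measurable_funTS; exact: continuous_measurable_fun.
have i1 : nu.-integrable D (EFin \o cst 1).
  exact: finite_measure_integrable_cst.
have one (B : set R) : measurable B ->
    fine (\int[nu]_(x in D `&` B) (cst 1 x)%:E)%E = fine (nu B).
  move=> mB; transitivity (fine (\int[nu]_(x in D `&` B) cst 1%E x)%E) => //.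
  rewrite integral_cst; last exact: measurableI.
  by rewrite mul1e; congr fine; exact/esym/nuD.
have EM : E = fun h => \int[nu]_(x in D) (h x * cst 1 x).
  by apply/funext => h; apply: eq_Rintegral => x _; rewrite mulr1.
have Ephi : E (phi n) @[n --> \oo] --> fine (nu S).
  rewrite EM -one//.
  exact: cvg_indicator mD mS i1
    (fun n => mtr n _) (fun n => trapezoid_itv n _) phiE.
have Epsi : E (psi n) @[n --> \oo] --> (1 : R).
  have <- : fine (nu setT) = 1 by rewrite probability_setT.
  rewrite EM -one//.
  exact: cvg_indicator mD measurableT i1
    (fun n => mtr n _) (fun n => trapezoid_itv n _) psiE.
have Jphi : J (phi n) @[n --> \oo] --> fine (weibull_prob lambda k S).
  rewrite weibull_probI// setIC.
  exact: cvg_indicator mDl mSl ifD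
    (fun n => mtr n _) (fun n => trapezoid_itv n _) phiE.
have Jpsi : J (psi n) @[n --> \oo] --> (1 : R).
  have := cvg_indicator mDl measurableT ifD
    (fun n => mtr n _) (fun n => trapezoid_itv n _) psiE.
  by rewrite setIT integral_weibull_pdf.
have WS : weibull_prob lambda k S \is a fin_num.
  have mSD := measurableI _ _ mSl mDl.
  rewrite weibull_probI//; apply: (integrable_fin_num mSD).
  exact: (integrableS mDl mSD (@subIsetr _ _ _) ifD).
rewrite -(fineK WS) -(fineK (fin_num_measure nu S mS)); congr EFin.
have h1 : E (phi n) * J (psi n) @[n --> \oo] --> fine (nu S).
  by rewrite -[X in _ --> X]mulr1; exact: cvgM.
have h2 : E (psi n) * J (phi n) @[n --> \oo] --> fine (weibull_prob lambda k S).
  by rewrite -[X in _ --> X]mul1r; exact: cvgM.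
rewrite (funext eqn) in h1.
by apply: (cvg_unique _ h1 h2).
Unshelve. all: by end_near. Qed.

Lemma identity_weibull (A : set R) : measurable A ->
  nu A = weibull_prob lambda k A.
Proof.
have mG : measurable = <<s @RGenInftyO.G R >> := @RGenInftyO.measurableE R.
have setIG : setI_closed (@RGenInftyO.G R).
  move=> _ _ [x ->] [y ->]; exists (Num.min x y).
  by apply/seteqP; split => z /=; rewrite !in_itv/= lt_min => /andP.
pose g (n : nat) : set R := `]-oo, n%:R[%classic.
have Gg n : @RGenInftyO.G R (g n) by exists n%:R.
have g_cover : \bigcup_n g n = setT.
  apply/seteqP; split => // x _; exists (Num.truncn x).+1 => //=.
  by rewrite /g/= in_itv/= truncnS_gt.
have nuW (B : set R) : @RGenInftyO.G R B ->
    nu B = weibull_measure lambda_gt0 k_gt0 B.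
  by move=> [x ->]; exact: distribution_ray.
have nug n : (nu (g n) < +oo)%E.
  by rewrite (le_lt_trans (probability_le1 _ _)) ?ltry//; exact: measurable_itv.
by move=> mA; exact: (measure_unique _ g mG setIG Gg g_cover nu _ nuW nug A mA).
Qed.

End characterization.

Theorem theorem1 (R : realType) (lambda k : R)
    (lambda_gt0 : 0 < lambda) (k_gt0 : 0 < k)
    (d : measure_display) (T : measurableType d) (P : probability T R)
    (X : {RV P >-> R}) (X_gt0 : {ae P, forall w, 0 < X w})
    (score_integrable :
      ('E_P[(fun w => `| X w * (weibull_pdf lambda k)^`()%classic (X w)
                         / weibull_pdf lambda k (X w) |)%R] < +oo)%E) :
  has_weibull_distribution X lambda k <->
  (forall t : R, 0 < t ->
    (t%:E * laplace_transform P X t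
     = 'E_P[(fun w => (X w)^-1 * (k * (X w / lambda) `^ k - k + 1)
                      * (1 - expR (- t * X w)))%R])%E).
Proof.
pose D : set R := `]0, +oo[%classic.
have mD : measurable D by exact: measurable_itv.
pose c : R -> R := weibull_score lambda k; pose nu := distribution P X.
have mc : measurable_fun [set: R] c by exact: measurable_weibull_score.
have ic : nu.-integrable D (EFin \o c).
  have mcD : measurable_fun [set: R] (c \_ D).
    by apply/(measurable_restrictT _ _).1 => //; exact: measurable_funTS.
  apply: (eq_integrable mD (EFin \o (c \_ D))).
    by move=> x xD; rewrite /= patchE xD.
  (* [c \_ D] and [x f'(x) / f(x)] have the same absolute value everywhere,
     so measurability of the derivative is not needed *)
  apply: integrable_distribution => //; apply: le_lt_trans score_integrable.
  rewrite le_eqVlt; apply/orP; left; apply/eqP; congr expectation.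
  apply/funext => w; rewrite weibull_scoreE// patchE.
  have -> : (X w \in D) = (0 < X w).
    by apply/idP/idP; rewrite inE /D /= in_itv/= andbT.
  by case: ifP; rewrite ?normrN.
have lhsE t : 0 < t ->
    (laplace_transform P X t = \int[nu]_(x in D) (expR (- t * x))%:E)%E.
  move=> t0; apply: (expectation_distribution X_gt0 (measurable_expRM t)).
  exact: integrable_laplace_kernel (ltW t0).
have rhsE t : 0 < t ->
    ('E_P[(fun w => (X w)^-1 * (k * (X w / lambda) `^ k - k + 1)
                      * (1 - expR (- t * X w)))%R]
    = \int[nu]_(x in D) (x^-1 * c x * (1 - expR (- t * x)))%:E)%E.
  move=> t0.
  have m1 : measurable_fun [set: R] (fun x : R => 1 - expR (- t * x)).
    by apply: measurable_funB => //; exact: measurable_expRM.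
  apply: (expectation_distribution X_gt0 (measurable_score_term lambda k m1)).
  exact: integrable_onem_laplace_kernel (ltW t0) ic.
split=> [hW t t0|identity A mA].
  by rewrite lhsE// rhsE//; exact: weibull_identity.
apply: (identity_weibull lambda_gt0 k_gt0 _ ic) => //.
  exact: distribution_gt0C.
by move=> t t0; rewrite -lhsE// -rhsE//; exact: identity.
Qed.
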